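(* Let $n\ge 2$, let $x=(x_1,\dots,x_n)\in\mathbb{R}^n$ be fixed, let $d_2=2/\sqrt{\pi}$, and let $\Pi$ be a uniformly random permutation of $\{1,\dots,n\}$. Define $$T(x,\Pi)=\frac{1}{d_2}\cdot\frac{1}{n-1}\sum_{t=2}^{n}\bigl|x_{\Pi(t)}-x_{\Pi(t-1)}\bigr|,\qquad \bar T(x)=\mathbb{E}_{\Pi}\{T(x,\Pi)\}.$$ Then $$\bar T(x)=\frac{\mathrm{GMD}(x)}{d_2},\qquad\text{where}\qquad \mathrm{GMD}(x)=\frac{2}{n(n-1)}\sum_{1\le i<j\le n}|x_i-x_j|.$$
   Context: $\mathbb{E}_{\Pi}$ denotes expectation over the uniformly random permutation $\Pi$ (i.e. the average over all $n!$ permutations) with $x$ held fixed. $\mathrm{GMD}(x)$ is the sample Gini mean difference. The symbol $\pi$ in $d_2=2/\sqrt{\pi}$ is the circle constant. *)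

(* Defs.v *)
From mathcomp Require Import all_boot all_order all_algebra all_fingroup.
From mathcomp Require Import reals trigo.

Set Implicit Arguments.
Unset Strict Implicit.
Unset Printing Implicit Defensive.

Import Order.TTheory GRing.Theory Num.Theory.
Local Open Scope ring_scope.

(* The sample (x_1, ..., x_n) is the row vector with entries x 0 0, ..., x 0 (n-1). *)

Definition d2 (R : realType) : R := 2 / Num.sqrt pi.

(* [t : 'I_n] with [0 < t] is the 0-based index of the times 2, ..., n.
   [ord_pred] is cyclic on ['I_n]; for [0 < t] its value is [t.-1]. *)
Definition Tstat (R : realType) (n : nat) (x : 'rV[R]_n) (s : 'S_n) : R :=
  (d2 R)^-1 * ((n%:R - 1)^-1 *
    \sum_(t < n | (0 < t)%N) `|x 0 (s t) - x 0 (s (ord_pred t))|).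

Definition expect_perm (R : realType) (n : nat) (f : 'S_n -> R) : R :=
  (n`!%:R)^-1 * \sum_(s : 'S_n) f s.

Definition Tbar (R : realType) (n : nat) (x : 'rV[R]_n) : R :=
  expect_perm (Tstat x).

Definition GMD (R : realType) (n : nat) (x : 'rV[R]_n) : R :=
  2 / (n%:R * (n%:R - 1)) *
    \sum_(i < n) \sum_(j < n | (i < j)%N) `|x 0 i - x 0 j|.

(* Main.v *)
Require Import Defs.
From mathcomp Require Import all_boot all_order all_algebra all_fingroup.
From mathcomp Require Import reals trigo.
From mathcomp Require Import ring.

Set Implicit Arguments.
Unset Strict Implicit.
Unset Printing Implicit Defensive.

Import Order.TTheory GRing.Theory Num.Theory.
Local Open Scope ring_scope.

(* The symmetric group acts transitively on ordered pairs of distinct points, so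
   the sum over all s of F (s a) (s b) does not depend on the pair a != b.
   Averaging it over all pairs gives the mean of F over ordered pairs of distinct
   points.  Each of the n - 1 consecutive differences in T therefore has
   expectation GMD(x). *)

Lemma perm_pair_exists (T : finType) (a b c d : T) :
  a != b -> c != d -> exists p : {perm T}, p a = c /\ p b = d.
Proof.
(* The first transposition sends [a] to [c] and [b] to some [b']; the second sends [b'] to [d] and
   fixes [c], since [b' != c] and [d != c]. *)
move=> ab cd; exists (tperm a c * tperm (tperm a c b) d)%g.
rewrite !permM tpermL; split; last by rewrite tpermL.
apply: tpermD; last by rewrite eq_sym.
by rewrite -[X in _ != X](tpermL a c) (inj_eq perm_inj) eq_sym.
Qed.

Lemma sum_perm_pair_eq (V : nmodType) (T : finType) (F : T -> T -> V)
    (a b c d : T) : a != b -> c != d ->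
  \sum_(s : {perm T}) F (s a) (s b) = \sum_(s : {perm T}) F (s c) (s d).
Proof.
move=> ab cd; have [p [<- <-]] := perm_pair_exists ab cd.
(* Left translation by [p] permutes the group, and [p * s] applies [p] first. *)
rewrite (reindex_inj (mulgI p)).
by apply: eq_bigr => s _; rewrite !permM.
Qed.

(** Double counting over ordered pairs of distinct points and permutations. Multiples replace
    quotients because [V] is only an additive monoid. *)
Lemma sum_perm_pair (V : nmodType) (T : finType) (F : T -> T -> V) (a b : T) :
  a != b ->
  (\sum_(s : {perm T}) F (s a) (s b)) *+ (#|T| * #|T|.-1) =
  (\sum_i \sum_(j | j != i) F i j) *+ #|T|`!.
Proof.
move=> ab.
transitivity (\sum_c \sum_(d | d != c) \sum_(s : {perm T}) F (s c) (s d)).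
  rewrite mulnC mulrnA -sumr_const; apply: eq_bigr => c _.
  rewrite -(cardC1 c) -sumr_const; apply: eq_bigr => d dc.
  by apply: sum_perm_pair_eq; rewrite // eq_sym.
under eq_bigr do rewrite exchange_big.
(* The factorial is turned into a count of permutations, so both sides become sums over [s]. *)
rewrite exchange_big /= -cardsT -card_perm.
rewrite -(@eq_card _ predT) => [|s]; last by rewrite !inE; apply/esym/subsetP.
rewrite -sumr_const; apply: eq_bigr => s _.
(* A fixed [s] acts bijectively on the off-diagonal pairs. *)
rewrite [RHS](reindex_inj (@perm_inj _ s)); apply: eq_bigr => c _.
rewrite [RHS](reindex_inj (@perm_inj _ s)); apply: eq_bigl => d.
by rewrite (inj_eq perm_inj).
Qed.

Lemma sum_neq_sym (V : nmodType) (n : nat) (F : 'I_n -> 'I_n -> V) :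
  (forall i j, F i j = F j i) ->
  \sum_i \sum_(j | j != i) F i j = (\sum_(i < n) \sum_(j < n | (i < j)%N) F i j) *+ 2.
Proof.
move=> Fsym; rewrite mulr2n.
have -> : \sum_i \sum_(j | j != i) F i j =
    \sum_(i < n) (\sum_(j < n | (i < j)%N) F i j + \sum_(j < n | (j < i)%N) F i j).
  apply: eq_bigr => i _; rewrite (bigID (fun j : 'I_n => (i < j)%N)) /=.
  by congr (_ + _); apply: eq_bigl => j; rewrite -val_eqE /=; case: ltngtP.
rewrite big_split /=; congr (_ + _).
rewrite (exchange_big_dep predT) //=.
by apply: eq_bigr => i _; apply: eq_bigr.
Qed.

(** Positivity of [t] rules out the cyclic wrap-around, so the predecessor is strictly smaller. *)
Lemma ord_pred_neq (n : nat) (t : 'I_n) : (0 < t)%N -> t != ord_pred t.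
Proof.
case: n t => [[]//|n] [[|t] ht] //= _; rewrite -val_eqE /=.
rewrite modnDr modn_small; last exact: ltnW.
by rewrite gtn_eqF.
Qed.

Theorem proposition2 (R : realType) (n : nat) (hn : (2 <= n)%N) (x : 'rV[R]_n) :
  Tbar x = GMD x / d2 R.
Proof.
(* From here on the sample size is [n.+1], and [hn] gives [0 < n]. *)
case: n hn x => [//|n] hn x.
pose F (i j : 'I_n.+1) : R := `|x 0 i - x 0 j|.
set G := \sum_i \sum_(j | j != i) F i j.
have n0 : n%:R != 0 :> R by rewrite pnatr_eq0 -lt0n.
have n1 : n.+1%:R != 0 :> R by rewrite pnatr_eq0.
have f0 : n.+1`!%:R != 0 :> R by rewrite pnatr_eq0 -lt0n fact_gt0.
have expF (t : 'I_n.+1) : (0 < t)%N ->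
    \sum_(s : 'S_n.+1) F (s t) (s (ord_pred t)) = n.+1`!%:R * G / (n.+1%:R * n%:R).
  move=> t0; apply: (mulIf (mulf_neq0 n1 n0)); rewrite divfK ?mulf_neq0 //.
  have := sum_perm_pair F (ord_pred_neq t0).
  by rewrite card_ord -natrM mulr_natr => ->; rewrite mulr_natl.
have GE : G = 2 * \sum_(i < n.+1) \sum_(j < n.+1 | (i < j)%N) F i j.
  by rewrite /G sum_neq_sym ?mulr_natl // => i j; rewrite /F distrC.
have nB1 : n.+1%:R - 1 = n%:R :> R by rewrite -natr1 addrK.
rewrite /Tbar /expect_perm /Tstat /GMD -2!mulr_sumr exchange_big /= nB1.
rewrite (eq_bigr _ expF) sumr_const.
(* The number of consecutive differences, which cancels the factor [n%:R^-1] in [T]. *)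
have -> : #|[pred t : 'I_n.+1 | (0 < t)%N]| = n.
  transitivity #|predC1 (ord0 : 'I_n.+1)|; last by rewrite cardC1 card_ord.
  by apply: eq_card => t; rewrite !inE lt0n.
rewrite -[X in _ * (_ * (_ * X))]mulr_natr.
transitivity (G / (n.+1%:R * n%:R) / d2 R); last by rewrite GE (mulrAC 2).
(* The inverse of [d2 R], the factorial and the two sizes become atoms, leaving a rational
   identity. *)
move: (d2 R)^-1 f0 n1 n0 => y; move: n.+1`!%:R n.+1%:R n%:R => c a b c0 a0 b0.
by field; rewrite c0 a0 b0.
Qed.
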